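(* Let $g_0,g_+,g_-\in\mathbb R$ and consider the two-player three-action game with action set $\{E,0,1\}$ for each player and payoff matrices (rows: Alice's action, columns: Bob's action, both ordered $(E,0,1)$) $$\mathsf A=\begin{pmatrix} 0 & 0 & 0 \\ -1 & g_0 & g_+ \\ -1 & g_- & g_0 \end{pmatrix}\ (\text{Alice}),\qquad \mathsf B=\begin{pmatrix} 0 & -1 & -1 \\ 0 & g_0 & g_+ \\ 0 & g_- & g_0 \end{pmatrix}\ (\text{Bob}).$$ Assume $g_0\neq g_+$, $g_0\neq g_-$, and that every Nash equilibrium (pure or mixed) of the associated active game has nonzero reward. Let $n_+$ be the number of Nash equilibria (pure or mixed) of the active game with positive reward. Then the three-action game has exactly $1+2n_+$ Nash equilibria (pure or mixed), and all of them are trembling-hand perfect. In particular, the number $N_{\mathrm{THP}}$ of trembling-hand perfect equilibria of the three-action game satisfies $N_{\mathrm{THP}}=1+2n_+\in\{1,3,5,7\}$.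
   Context: The active game is the two-player game with action set $\{0,1\}$ for each player in which both players receive the same payoff, given by the matrix $\mathsf G=\begin{pmatrix} g_0 & g_+ \\ {g_-} & g_0 \end{pmatrix}$ (rows: Alice's action $0,1$; columns: Bob's action $0,1$). The reward of a Nash equilibrium of the active game is the common expected payoff at that equilibrium. A strategy is a probability distribution on the player's action set. A Nash equilibrium is a pair of strategies such that every action in the support of each player's strategy maximizes that player's expected payoff against the other player's strategy. A strategy profile of a finite two-player game is trembling-hand perfect if it is the limit of a sequence of completely mixed profiles (each player gives strictly positive probability to every action) such that, along the sequence, every action in the support of each player's strategy in the limit profile is a best response to the other player's completely mixed strategy. *)

(* Defs.v *)
From HB Require Import structures.
From mathcomp Require Import all_boot all_order all_algebra.
From mathcomp Require Import all_classical all_reals all_analysis.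

Set Implicit Arguments.
Unset Strict Implicit.
Unset Printing Implicit Defensive.

Import Order.TTheory GRing.Theory Num.Theory numFieldNormedType.Exports.
Local Open Scope classical_set_scope.
Local Open Scope ring_scope.

Section Bimatrix.
Variables (R : realType) (m n : nat).
Implicit Types (A B : 'M[R]_(m, n)) (x : 'rV[R]_m) (y : 'rV[R]_n).

(* Both players' strategies are row vectors indexed by their actions; in both
   payoff matrices rows are Alice's actions and columns are Bob's. *)
Definition strategy k (x : 'rV[R]_k) : Prop :=
  (forall i, 0 <= x 0 i) /\ \sum_i x 0 i = 1.

Definition completely_mixed k (x : 'rV[R]_k) : Prop :=
  strategy x /\ forall i, 0 < x 0 i.

Definition payoff A x y : R := \sum_i \sum_j x 0 i * A i j * y 0 j.

Definition alice_best_response A y (i : 'I_m) : Prop :=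
  forall i', \sum_j A i' j * y 0 j <= \sum_j A i j * y 0 j.

Definition bob_best_response B x (j : 'I_n) : Prop :=
  forall j', \sum_i x 0 i * B i j' <= \sum_i x 0 i * B i j.

(* For strategies, [x 0 i != 0] says that [i] is in the support of [x]. *)
Definition support_best_response A B (p q : 'rV[R]_m * 'rV[R]_n) : Prop :=
  (forall i, p.1 0 i != 0 -> alice_best_response A q.2 i) /\
  (forall j, p.2 0 j != 0 -> bob_best_response B q.1 j).

Definition nash A B (p : 'rV[R]_m * 'rV[R]_n) : Prop :=
  [/\ strategy p.1, strategy p.2 & support_best_response A B p p].

Definition trembling_hand_perfect A B (p : 'rV[R]_m * 'rV[R]_n) : Prop :=
  [/\ strategy p.1, strategy p.2 &
    exists u : nat -> 'rV[R]_m * 'rV[R]_n,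
      [/\ u @ \oo --> p,
          forall k, completely_mixed (u k).1 /\ completely_mixed (u k).2 &
          forall k, support_best_response A B p (u k)]].

End Bimatrix.

Section Games.
Variables (R : realType) (g0 gp gm : R).

Definition mx_of_rows (m n : nat) (s : seq (seq R)) : 'M[R]_(m, n) :=
  \matrix_(i, j) nth 0 (nth [::] s i) j.

Definition active_mx : 'M[R]_2 :=
  mx_of_rows 2 2 [:: [:: g0; gp];
                     [:: gm; g0]].

(* Index 0 is the action E; indices 1 and 2 are the actions 0 and 1. *)
Definition alice_mx : 'M[R]_3 :=
  mx_of_rows 3 3 [:: [::  0;  0;  0];
                     [:: -1; g0; gp];
                     [:: -1; gm; g0]].

Definition bob_mx : 'M[R]_3 :=
  mx_of_rows 3 3 [:: [:: 0; -1; -1];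
                     [:: 0; g0; gp];
                     [:: 0; gm; g0]].

Definition active_nash : 'rV[R]_2 * 'rV[R]_2 -> Prop :=
  nash active_mx active_mx.

Definition reward (p : 'rV[R]_2 * 'rV[R]_2) : R := payoff active_mx p.1 p.2.

End Games.

(* Main.v *)
Require Import Defs.
From HB Require Import structures.
From mathcomp Require Import all_boot all_order all_algebra.
From mathcomp Require Import all_classical all_reals all_analysis.
From mathcomp Require Import lra.

Import Order.TTheory GRing.Theory Num.Theory numFieldNormedType.Exports.
Local Open Scope classical_set_scope.
Local Open Scope card_scope.
Local Open Scope ring_scope.

Set Implicit Arguments.
Unset Strict Implicit.
Unset Printing Implicit Defensive.

(** Let both players play actively with probabilities [s], [t], and otherwise
    exit.  If one exits for sure, so does the other.  Otherwise their active
    parts [(x, y)] form an equilibrium of the active game, with reward [r] say,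
    and playing actively against [t] yields [t (1 + r) - 1], to be compared with
    [0].  Hence [r < 0] is impossible, [r = 0] is excluded, and for [r > 0] the
    two indifference conditions leave exactly [s = t = 1] and [s = t = 1 / (1 + r)].

    For perfection, the exit equilibrium is strict.  Since [g0 <> gp] and
    [g0 <> gm], an active equilibrium is either completely mixed or strict, so it
    is a limit of completely mixed [v k] tolerated by the opponent's support;
    with [r k] the reward against [v k], the profiles playing [v k] with
    probability [1 / (1 + r k)] (resp. [1 - 1 / (k + 1)]) approximate the
    equilibrium [s = 1 / (1 + r)] (resp. [s = 1]).

    Bob's conditions are Alice's for the transposed matrices, so that each
    argument is carried out for one player only. *)

(** * Best responses, one player at a time *)

Definition action_payoff (R : realType) m n (A : 'M[R]_(m, n)) (y : 'rV[R]_n)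
  (i : 'I_m) : R := \sum_j A i j * y 0 j.

(** One player's half of the equilibrium condition; Bob's half is the same predicate for [B^T]. *)
Definition supports_br (R : realType) m n (A : 'M[R]_(m, n)) (x : 'rV[R]_m)
    (y : 'rV[R]_n) : Prop :=
  forall i, x 0 i != 0 -> alice_best_response A y i.

Section BestResponses.
Variable R : realType.

Lemma strategy_support n (x : 'rV[R]_n) : strategy x -> exists i, x 0 i != 0.
Proof.
move=> [x0 x1]; apply/existsP; apply: contraT; rewrite negb_exists => /forallP h.
have /eqP := x1; rewrite big1 => [|i _]; first by rewrite eq_sym oner_eq0.
by have := h i; rewrite negbK => /eqP.
Qed.

Lemma strategy_delta n (j : 'I_n) : strategy (delta_mx 0 j : 'rV[R]_n).
Proof.
split=> [i|]; first by rewrite mxE ler0n.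
rewrite (bigD1 j)//= mxE !eqxx big1 ?addr0// => i ij.
by rewrite mxE (negbTE ij) andbF.
Qed.

Lemma bob_best_responseE m n (B : 'M[R]_(m, n)) x j :
  bob_best_response B x j <-> alice_best_response B^T x j.
Proof.
have e k : \sum_i B^T k i * x 0 i = \sum_i x 0 i * B i k.
  by apply: eq_bigr => i _; rewrite mxE mulrC.
by split=> h k; have := h k; rewrite !e.
Qed.

Lemma support_best_responseE m n (A B : 'M[R]_(m, n)) p q :
  support_best_response A B p q <->
  supports_br A p.1 q.2 /\ supports_br B^T p.2 q.1.
Proof.
by split=> -[h1 h2]; split=> // j /h2 /bob_best_responseE.
Qed.

Lemma nashE m n (A B : 'M[R]_(m, n)) p :
  nash A B p <-> [/\ strategy p.1, strategy p.2, supports_br A p.1 p.2 &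
    supports_br B^T p.2 p.1].
Proof.
by split=> [[h1 h2 /support_best_responseE[h3 h4]]|[h1 h2 h3 h4]]; split=> //;
  apply/support_best_responseE.
Qed.

Lemma payoffE m n (A : 'M[R]_(m, n)) x y :
  payoff A x y = \sum_i x 0 i * action_payoff A y i.
Proof.
apply: eq_bigr => i _; rewrite mulr_sumr.
by apply: eq_bigr => j _; rewrite mulrA.
Qed.

Lemma payoff_trmx m n (A : 'M[R]_(m, n)) x y : payoff A^T y x = payoff A x y.
Proof.
rewrite /payoff exchange_big; apply: eq_bigr => i _; apply: eq_bigr => j _.
by rewrite mxE mulrC [y _ _ * _]mulrC mulrA.
Qed.

(** All supported actions earn the same maximal amount, so averaging over the support returns that
    amount. *)
Lemma payoff_supports_br m n (A : 'M[R]_(m, n)) x y i :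
  strategy x -> supports_br A x y -> x 0 i != 0 ->
  action_payoff A y i = payoff A x y.
Proof.
move=> [_ x1] br xi; rewrite payoffE -[LHS]mul1r -x1 mulr_suml.
apply: eq_bigr => k _; have [->|xk] := eqVneq (x 0 k) 0; first by rewrite !mul0r.
by congr (_ * _); apply/le_anti/andP; split; [exact: (br k)|exact: (br i)].
Qed.

Lemma action_payoff_le m n (A : 'M[R]_(m, n)) x y i :
  strategy x -> supports_br A x y -> action_payoff A y i <= payoff A x y.
Proof.
move=> sx br; have [k xk] := strategy_support sx.
by rewrite -(payoff_supports_br sx br xk); exact: br.
Qed.

End BestResponses.

(** * Adjoining an exit action to an active game *)

Section ExitGame.
Variable R : realType.

Definition exit_mx m n (G : 'M[R]_(m, n)) : 'M[R]_(1 + m, 1 + n) :=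
  block_mx 0 0 (const_mx (-1)) G.

Definition play n (s : R) (x : 'rV[R]_n) : 'rV[R]_(1 + n) :=
  row_mx (const_mx (1 - s)) (s *: x).

Lemma play_l n s (x : 'rV[R]_n) (i : 'I_1) : play s x 0 (lshift n i) = 1 - s.
Proof. by rewrite row_mxEl mxE. Qed.

Lemma play_r n s (x : 'rV[R]_n) i : play s x 0 (rshift 1 i) = s * x 0 i.
Proof. by rewrite row_mxEr mxE. Qed.

(** Sure exit forgets the active part. Its normal form is [play 0 0], although the zero vector is no
    strategy. *)
Lemma play0 n (x : 'rV[R]_n) : play 0 x = play 0 0.
Proof. by rewrite /play !scale0r. Qed.

Lemma play_inj n s t (x y : 'rV[R]_n) :
  s != 0 -> play s x = play t y -> s = t /\ x = y.
Proof.
move=> s0 /eq_row_mx[/rowP/(_ 0)]; rewrite !mxE => st.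
have {st} <- : s = t by lra.
by move=> /(scalerI s0).
Qed.

Lemma strategy_play n s (x : 'rV[R]_n) : 0 <= s <= 1 -> strategy x ->
  strategy (play s x).
Proof.
move=> /andP[s0 s1] [x0 x1]; split=> [i|].
  by case: (split_ordP i) => k ->; rewrite ?play_l ?play_r ?mulr_ge0 ?subr_ge0.
rewrite big_split_ord/= big_ord1 play_l.
under eq_bigr do rewrite play_r.
by rewrite -mulr_sumr x1; lra.
Qed.

Lemma strategy_exit n : strategy (play 0 0 : 'rV[R]_(1 + n.+1)).
Proof.
rewrite -(play0 (delta_mx 0 0)); apply: strategy_play (strategy_delta _ _).
by rewrite lexx ler01.
Qed.

Lemma completely_mixed_play n s (x : 'rV[R]_n) : 0 < s < 1 ->
  completely_mixed x -> completely_mixed (play s x).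
Proof.
move=> /andP[s0 s1] [sx x0]; split; first by apply: strategy_play; rewrite ?ltW.
by move=> i; case: (split_ordP i) => k ->;
  rewrite ?play_l ?play_r ?mulr_gt0 ?subr_gt0.
Qed.

(** The active part divided by its total mass [s] is the conditional strategy; for [s = 0] an
    arbitrary one is supplied. *)
Lemma strategyP n (z : 'rV[R]_(1 + n.+1)) : strategy z ->
  exists s x, [/\ 0 <= s <= 1, strategy x & z = play s x].
Proof.
move=> [z0 z1].
have sum1 : z 0 (lshift _ 0) + \sum_(j < n.+1) z 0 (rshift 1 j) = 1.
  by rewrite -z1 big_split_ord/= big_ord1.
have ge0 : 0 <= \sum_(j < n.+1) z 0 (rshift 1 j) by apply: sumr_ge0.
set s := \sum_(j < n.+1) z 0 (rshift 1 j) in sum1 ge0.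
have s01 : 0 <= s <= 1 by rewrite ge0/= -sum1 lerDr.
have zl (k : 'I_1) : z 0 (lshift n.+1 k) = 1 - s by rewrite ord1; lra.
have [s0|s0] := eqVneq s 0.
  exists s, (delta_mx 0 0); split=> //; first exact: strategy_delta.
  apply/rowP => i; case: (split_ordP i) => k ->; rewrite ?play_l ?play_r//.
  rewrite s0 mul0r; apply/eqP; apply: contraTT isT => zk.
  have := s0; rewrite /s (bigD1 k)//= => /eqP; rewrite paddr_eq0 ?sumr_ge0//.
  by rewrite (negbTE zk).
exists s, (\row_j (s^-1 * z 0 (rshift 1 j))); split=> //.
  split=> [i|]; first by rewrite mxE mulr_ge0// invr_ge0.
  under eq_bigr do rewrite mxE.
  by rewrite -mulr_sumr mulVf.
apply/rowP => i; case: (split_ordP i) => k ->; rewrite ?play_l ?play_r//.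
by rewrite mxE mulrA divff// mul1r.
Qed.

Lemma exit_mxEu m n (G : 'M[R]_(m, n)) (i : 'I_1) j :
  exit_mx G (lshift m i) j = 0.
Proof.
by rewrite /exit_mx col_mxEu; case: (split_ordP j) => k ->;
  rewrite ?row_mxEl ?row_mxEr mxE.
Qed.

Lemma exit_mxEdl m n (G : 'M[R]_(m, n)) i (j : 'I_1) :
  exit_mx G (rshift 1 i) (lshift n j) = -1.
Proof. by rewrite /exit_mx block_mxEdl mxE. Qed.

Lemma exit_mxEdr m n (G : 'M[R]_(m, n)) i j :
  exit_mx G (rshift 1 i) (rshift 1 j) = G i j.
Proof. by rewrite /exit_mx block_mxEdr. Qed.

Lemma action_payoff_exit_l m n (G : 'M[R]_(m, n)) z (i : 'I_1) :
  action_payoff (exit_mx G) z (lshift m i) = 0.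
Proof.
by rewrite /action_payoff big1 // => j _; rewrite exit_mxEu mul0r.
Qed.

Lemma action_payoff_exit_r m n (G : 'M[R]_(m, n)) t y i :
  action_payoff (exit_mx G) (play t y) (rshift 1 i) =
  t * action_payoff G y i - (1 - t).
Proof.
rewrite /action_payoff big_split_ord/= big_ord1 play_l.
rewrite exit_mxEdl mulN1r addrC; congr (_ - _).
rewrite mulr_sumr; apply: eq_bigr => j _.
by rewrite play_r exit_mxEdr mulrCA.
Qed.

(** With [r = payoff G x y], supported active actions earn [t * (1 + r) - 1], the other active ones
    at most that, and exit earns 0, so only exit and activity need comparing. *)
Lemma supports_br_play m n (G : 'M[R]_(m, n)) s t x y :
  0 <= t -> strategy x -> supports_br G x y ->
  supports_br (exit_mx G) (play s x) (play t y) <->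
  (s != 0 -> 1 <= t * (1 + payoff G x y)) /\
  (s != 1 -> t * (1 + payoff G x y) <= 1).
Proof.
move=> t0 sx br; have [i0 xi0] := strategy_support sx.
have v := payoff_supports_br sx br; have le i := action_payoff_le i sx br.
have E i : alice_best_response (exit_mx G) (play t y) i ->
    forall k, action_payoff (exit_mx G) (play t y) k <=
    action_payoff (exit_mx G) (play t y) i by exact.
split=> [h|[h1 h2] i].
- split=> s0.
    have /h /E/(_ (lshift m 0)) : play s x 0 (rshift 1 i0) != 0.
      by rewrite play_r mulf_neq0.
    by rewrite action_payoff_exit_l action_payoff_exit_r v//; lra.
  have /h /E/(_ (rshift 1 i0)) : play s x 0 (lshift m 0) != 0.
    by rewrite play_l subr_eq0 eq_sym.
  by rewrite action_payoff_exit_l action_payoff_exit_r v//; lra.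
- case: (split_ordP i) => k -> + j.
    rewrite play_l subr_eq0 eq_sym => /h2 {}h2; rewrite -!/(action_payoff _ _ _).
    case: (split_ordP j) => l ->; rewrite !action_payoff_exit_l//.
    by rewrite action_payoff_exit_r; have := ler_wpM2l t0 (le l); lra.
  rewrite play_r mulf_eq0 negb_or => /andP[/h1 {}h1 xk].
  rewrite -!/(action_payoff _ _ _) action_payoff_exit_r v//.
  case: (split_ordP j) => l ->; rewrite ?action_payoff_exit_l; first by lra.
  by rewrite action_payoff_exit_r; have := ler_wpM2l t0 (le l); lra.
Qed.

(** For [t > 0], passing from [y] to [play t y] changes active payoffs by an increasing affine map,
    so their order is kept. *)
Lemma supports_br_of_play m n (G : 'M[R]_(m, n)) s t x y :
  s != 0 -> 0 < t -> supports_br (exit_mx G) (play s x) (play t y) ->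
  supports_br G x y.
Proof.
move=> s0 t0 h i xi j.
have /h/(_ (rshift 1 j)) : play s x 0 (rshift 1 i) != 0.
  by rewrite play_r mulf_neq0.
rewrite -!/(action_payoff _ _ _) !action_payoff_exit_r.
by rewrite lerD2r ler_pM2l.
Qed.

Lemma supports_br_exit m n (G : 'M[R]_(m, n)) t x y :
  (forall i, t * action_payoff G y i <= 1 - t) ->
  supports_br (exit_mx G) (play 0 x) (play t y).
Proof.
move=> h i; case: (split_ordP i) => k ->; last by rewrite play_r mul0r eqxx.
move=> _ j; rewrite -!/(action_payoff _ _ _) action_payoff_exit_l.
case: (split_ordP j) => l ->; rewrite ?action_payoff_exit_l//.
by rewrite action_payoff_exit_r subr_le0.
Qed.

(** Against sure exit every active action earns -1, less than the 0 earned by exiting. *)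
Lemma exit_of_supports_br m n (G : 'M[R]_(m, n)) s x y : strategy x ->
  supports_br (exit_mx G) (play s x) (play 0 y) -> s = 0.
Proof.
move=> /strategy_support[i xi] h; apply/eqP; apply: contraT => s0.
have /h/(_ (lshift m 0)) : play s x 0 (rshift 1 i) != 0.
  by rewrite play_r mulf_neq0.
rewrite -!/(action_payoff _ _ _) action_payoff_exit_l action_payoff_exit_r.
by rewrite mul0r; lra.
Qed.

Lemma nash_exit m n (G : 'M[R]_(m.+1, n.+1)) p :
  (forall q, nash G G q -> payoff G q.1 q.2 <> 0) ->
  nash (exit_mx G) (exit_mx G^T)^T p <->
  p = (play 0 0, play 0 0) \/
  exists q s, [/\ nash G G q, 0 < payoff G q.1 q.2,
    s = 1 \/ s = (1 + payoff G q.1 q.2)^-1 & p = (play s q.1, play s q.2)].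
Proof.
move=> reward_neq0; rewrite nashE trmxK; split.
  case: p => z w /= [/strategyP[s [x [s01 sx ->]]] /strategyP[t [y [t01 sy ->]]]].
  move=> h1 h2.
  have [s0|s0] := eqVneq s 0.
    move: h2; rewrite s0 => /(exit_of_supports_br sy) ->; left.
    by rewrite (play0 x) (play0 y).
  have [t0|t0] := eqVneq t 0.
    move: h1; rewrite t0 => /(exit_of_supports_br sx)/eqP.
    by rewrite (negbTE s0).
  have {}t01 : 0 < t <= 1 by rewrite lt_neqAle eq_sym t0.
  have {}s01 : 0 < s <= 1 by rewrite lt_neqAle eq_sym s0.
  case/andP: t01 s01 => tp t1 /andP[sp s1].
  have b1 := supports_br_of_play s0 tp h1.
  have b2 := supports_br_of_play t0 sp h2.
  have nq : nash G G (x, y) by apply/nashE.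
  have /eqP r0 := reward_neq0 _ nq.
  move/(supports_br_play _ (ltW tp) sx b1) : h1 => [/(_ s0) h1 h1'].
  move/(supports_br_play _ (ltW sp) sy b2) : h2 => [/(_ t0) h2 h2'].
  rewrite payoff_trmx in h2 h2'; rewrite /= in r0.
  move: r0 h1 h2 h1' h2'; set r := payoff G x y => r0 h1 h2 h1' h2'.
  (* A negative reward would give [t * (1 + r) < t <= 1], against [h1]. *)
  have rp : 0 < r.
    rewrite lt_neqAle eq_sym r0 leNgt /=; apply/negP => r_lt0.
    have tr : t * r < 0 by rewrite nmulr_llt0.
    by lra.
  have r1 : 1 + r != 0 by apply: lt0r_neq0; lra.
  right; exists (x, y), s; split=> //=.
    (* If [s != 1], then [t * (1 + r) <= 1] excludes [t = 1]; Bob's two conditions then give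
       [s * (1 + r) = 1]. *)
    have [->|/h1' h3] := eqVneq s 1; first by left.
    right; apply: (mulIf r1); rewrite mulVf//.
    by apply/le_anti; rewrite h2 andbT h2'//; apply/eqP => t1'; nra.
  (* What remains is [t = s]: if one of them is 1, so is the other, and otherwise
     [t * (1 + r) = s * (1 + r) = 1]. *)
  congr (_, play _ _).
  have [s1'|/h1' h3] := eqVneq s 1.
    have [->//|/h2'] := eqVneq t 1; nra.
  have /h2' h4 : t != 1 by apply/eqP => t1'; nra.
  by nra.
case=> [->/=|[[x y]] [s]].
  by split; try exact: strategy_exit; apply: supports_br_exit => i;
    rewrite mul0r subr0 ler01.
move=> [/nashE /=[sx sy b1 b2] r0 sE ->] /=.
have s01 : 0 < s <= 1.
  case: sE => ->; first by rewrite ltr01 lexx.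
  by rewrite invr_gt0 invf_le1; lra.
have s0 : 0 <= s <= 1 by lra.
have r1 : 1 + payoff G x y != 0 by apply: lt0r_neq0; lra.
have h : (s != 0 -> 1 <= s * (1 + payoff G x y)) /\
         (s != 1 -> s * (1 + payoff G x y) <= 1).
  case: sE => ->; first by rewrite eqxx; split=> //; lra.
  by rewrite mulVf.
split; try exact: strategy_play.
  by apply/supports_br_play => //; lra.
by apply/supports_br_play; rewrite ?payoff_trmx //; lra.
Qed.

End ExitGame.

(** * Entrywise limits of strategies and payoffs *)

Section Convergence.
Variable R : realType.

(** Boxes form a neighbourhood base, and finitely many conditions that hold along a filter hold
    jointly. *)
Lemma cvg_mx T (F : set_system T) {FF : Filter F} m n (f : T -> 'M[R]_(m, n))
  (M : 'M[R]_(m, n)) :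
  (forall i j, (fun t => f t i j) @ F --> M i j) -> f @ F --> M.
Proof.
move=> h A [P MP sPA]; suff : \forall t \near F, forall i j, P i j (f t i j).
  by apply: filterS => t Pt; apply: sPA.
by apply: filter_forall => i; apply: filter_forall => j; apply: h; exact: MP.
Qed.

Lemma cvg_coord T (F : set_system T) {FF : Filter F} m n
  (f : T -> 'M[R]_(m, n)) (M : 'M[R]_(m, n)) i j :
  f @ F --> M -> (fun t => f t i j) @ F --> M i j.
Proof. by move=> fM; apply: cvg_comp fM (@coord_continuous _ m n i j M). Qed.

Lemma cvg_action_payoff T (F : set_system T) {FF : Filter F} m n
    (A : 'M[R]_(m, n)) (f : T -> 'rV[R]_n) y i :
  f @ F --> y -> (fun t => action_payoff A (f t) i) @ F --> action_payoff A y i.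
Proof.
move=> fy; rewrite /action_payoff.
apply: (cvg_big (@add_continuous _)) => j _.
by apply: cvgM; [exact: cvg_cst|]; exact: cvg_coord.
Qed.

Lemma cvg_payoff T (F : set_system T) {FF : Filter F} m n (A : 'M[R]_(m, n)) x
    (f : T -> 'rV[R]_n) y :
  f @ F --> y -> (fun t => payoff A x (f t)) @ F --> payoff A x y.
Proof.
move=> fy; rewrite payoffE; under eq_fun do rewrite payoffE.
apply: (cvg_big (@add_continuous _)) => i _.
by apply: cvgM; [exact: cvg_cst|]; exact: cvg_action_payoff.
Qed.

Lemma cvg_play T (F : set_system T) {FF : Filter F} n (s : T -> R)
    (f : T -> 'rV[R]_n) a y :
  s @ F --> a -> f @ F --> y -> (fun t => play (s t) (f t)) @ F --> play a y.
Proof.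
move=> sa fy; apply: cvg_mx => i j; rewrite ord1.
case: (split_ordP j) => k ->.
  rewrite play_l; under eq_fun do rewrite play_l.
  by apply: cvgB => //; exact: cvg_cst.
rewrite play_r; under eq_fun do rewrite play_r.
by apply: cvgM => //; exact: cvg_coord.
Qed.

End Convergence.

(** * Trembling-hand perfection *)

Definition trembling (R : realType) m n (A : 'M[R]_(m, n)) (x : 'rV[R]_m)
    (y : 'rV[R]_n) : Prop :=
  exists v : nat -> 'rV[R]_n, [/\ v @ \oo --> y,
    forall k, completely_mixed (v k) & forall k, supports_br A x (v k)].

Section Trembling.
Variable R : realType.

(** Alice's best responses depend only on Bob's trembles and conversely, so the two sequences may be
    found separately and then paired. *)
Lemma trembling_hand_perfectE m n (A B : 'M[R]_(m, n)) p :
  trembling_hand_perfect A B p <->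
  [/\ strategy p.1, strategy p.2, trembling A p.1 p.2 & trembling B^T p.2 p.1].
Proof.
case: p => x y; split=> /= -[sx sy].
  move=> [u [uxy cm br]]; split=> //.
    exists (fun k => (u k).2); split=> [|k|k].
    - by apply: cvg_comp uxy _; exact: cvg_snd.
    - by have [] := cm k.
    - by have /support_best_responseE[] := br k.
  exists (fun k => (u k).1); split=> [|k|k].
  - by apply: cvg_comp uxy _; exact: cvg_fst.
  - by have [] := cm k.
  - by have /support_best_responseE[] := br k.
move=> [v [vy cv bv]] [w [wx cw bw]]; split=> //.
exists (fun k => (w k, v k)); split=> [|k|k] /=; [|by []|].
  exact: (@cvg_pair _ _ _ _ _ _ _ (nbhs_filter x) (nbhs_filter y) _ _ wx vy).
by apply/support_best_responseE; split; [exact: bv|exact: bw].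
Qed.

(** Dropping the first terms of the sequence turns eventual conditions into permanent ones. *)
Lemma trembling_near m n (A : 'M[R]_(m, n)) x y (v : nat -> 'rV[R]_n) :
  v @ \oo --> y ->
  (\forall k \near \oo, completely_mixed (v k) /\ supports_br A x (v k)) ->
  trembling A x y.
Proof.
move=> vy [N _ h]; exists (fun k => v (N + k)%N); split=> [|k|k].
- exact: cvg_comp (@cvg_addnl N) vy.
- by have [] := h _ (leq_addr k N).
- by have [] := h _ (leq_addr k N).
Qed.

(** Weak inequalities between payoffs pass to the limit. *)
Lemma trembling_supports_br m n (A : 'M[R]_(m, n)) x y :
  trembling A x y -> supports_br A x y.
Proof.
move=> [v [vy _ br]] i xi k.
apply: (ler_cvg_to (cvg_action_payoff (i := k) vy)
  (cvg_action_payoff (i := i) vy)).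
by apply: nearW => l; exact: br.
Qed.

Lemma trembling_hand_perfect_nash m n (A B : 'M[R]_(m, n)) p :
  trembling_hand_perfect A B p -> nash A B p.
Proof.
move=> /trembling_hand_perfectE[? ? ? ?]; apply/nashE.
by split=> //; exact: trembling_supports_br.
Qed.

Lemma completely_mixed_cst n :
  completely_mixed (const_mx n.+1%:R^-1 : 'rV[R]_n.+1).
Proof.
split; last by move=> i; rewrite mxE invr_gt0.
split=> [i|]; first by rewrite mxE invr_ge0.
under eq_bigr do rewrite mxE.
by rewrite sumr_const card_ord -[LHS]mulr_natl divff ?pnatr_eq0.
Qed.

Lemma trembling_play m n (G : 'M[R]_(m, n)) s x y :
  strategy x -> trembling G x y -> 0 < payoff G x y ->
  s = 1 \/ s = (1 + payoff G x y)^-1 ->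
  trembling (exit_mx G) (play s x) (play s y).
Proof.
move=> sx [v [vy cm br]] r0 sE.
have cv : (fun k => 1 + payoff G x (v k)) @ \oo --> 1 + payoff G x y.
  by apply: cvgD; [exact: cvg_cst|exact: cvg_payoff].
have r_gt0 : \forall k \near \oo, 1 < 1 + payoff G x (v k).
  by apply: (cvgr_gt _ cv); rewrite ltrDl.
case: sE => ->.
  have h0 : (fun k => 1 - harmonic k) @ \oo --> (1 : R).
    rewrite -[X in _ --> X]subr0.
    by apply: cvgB; [exact: cvg_cst|exact: cvg_harmonic].
  apply: trembling_near (cvg_play h0 vy) _.
  (* Activity is strictly better than exit in the limit, hence eventually along the trembles. *)
  have h1 : \forall k \near \oo,
      1 < (1 - harmonic k) * (1 + payoff G x (v k)).
    by apply: (cvgr_gt _ (cvgM h0 cv)); rewrite mul1r ltrDl.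
  (* [harmonic 0] is 1, so this fails at index 0. *)
  have h2 : \forall k \near \oo, 0 < 1 - harmonic k :> R.
    exact: (cvgr_gt _ h0).
  near=> k.
  have k0 : 0 < 1 - harmonic k :> R by near: k.
  split.
    by apply: completely_mixed_play => //; rewrite k0 gtrBl harmonic_gt0.
  apply/(supports_br_play _ (ltW k0) sx (br k)); rewrite eqxx; split=> // _.
  by apply: ltW; near: k.
(* Exit and activity are both in the support, so every tremble must keep them exactly indifferent;
   this dictates a probability that varies with [k]. *)
have h0 : (fun k => (1 + payoff G x (v k))^-1) @ \oo --> (1 + payoff G x y)^-1.
  by apply: cvgV => //; apply: lt0r_neq0; rewrite addr_gt0.
apply: trembling_near (cvg_play h0 vy) _; near=> k.
have rk : 1 < 1 + payoff G x (v k) by near: k.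
have rk0 : 0 < 1 + payoff G x (v k) by apply: lt_trans rk.
split.
  by apply: completely_mixed_play => //; rewrite invr_gt0 rk0 invf_lt1.
apply/(supports_br_play _ _ sx (br k)); first by rewrite invr_ge0 ltW.
by rewrite mulVf; [split|exact: lt0r_neq0].
Unshelve. all: by end_near. Qed.

(** Against an opponent who is active with small probability, activity earns nearly -1 and exit 0.
    The uniform active part makes the tremble completely mixed. *)
Lemma trembling_exit m n (G : 'M[R]_(m, n.+1)) :
  trembling (exit_mx G) (play 0 0) (play 0 0).
Proof.
pose v : 'rV[R]_n.+1 := const_mx n.+1%:R^-1.
have h0 := @cvg_harmonic R.
(* Since sure exit forgets the active part, the limit may be read as [play 0 v]. *)
rewrite -(play0 v); apply: trembling_near (cvg_play h0 (cvg_cst v)) _.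
have h1 : \forall k \near \oo, harmonic k < 1 :> R by exact: (cvgr_lt _ h0).
have h2 : \forall k \near \oo, forall i,
    harmonic k * (1 + action_payoff G v i) < 1.
  apply: filter_forall => i.
  apply: (cvgr_lt _ (cvgM h0 (cvg_cst (1 + action_payoff G v i)))).
  by rewrite mul0r.
near=> k; split.
  apply: completely_mixed_play (completely_mixed_cst n).
  by rewrite harmonic_gt0; near: k.
apply: supports_br_exit => i.
have : harmonic k * (1 + action_payoff G v i) < 1 by move: i; near: k.
by lra.
Unshelve. all: by end_near. Qed.

Lemma trembling_completely_mixed m n (A : 'M[R]_(m, n)) x y :
  completely_mixed y -> supports_br A x y -> trembling A x y.
Proof. by move=> cm br; exists (fun=> y); split=> //; exact: cvg_cst. Qed.

Lemma completely_mixed_conv n (t : R) (y v : 'rV[R]_n) : 0 < t <= 1 ->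
  strategy y -> completely_mixed v ->
  completely_mixed ((1 - t) *: y + t *: v).
Proof.
move=> /andP[t0 t1] [y0 y1] [[_ v1] v0].
have pos i : 0 < ((1 - t) *: y + t *: v) 0 i.
  by rewrite !mxE ltr_wpDl ?mulr_gt0 ?mulr_ge0 ?subr_ge0.
split=> //; split=> [i|]; first exact: ltW.
under eq_bigr do rewrite !mxE.
by rewrite big_split/= -!mulr_sumr y1 v1; lra.
Qed.

Lemma action_payoff_delta m n (A : 'M[R]_(m, n)) i j :
  action_payoff A (delta_mx 0 j) i = A i j.
Proof.
rewrite /action_payoff (bigD1 j)//= mxE !eqxx mulr1 big1 ?addr0// => k kj.
by rewrite mxE (negbTE kj) andbF mulr0.
Qed.

(** A column with distinct entries makes the best response to its pure action strict, and strict
    inequalities survive a small shift towards the uniform strategy. *)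
Lemma trembling_pure m n (A : 'M[R]_(m, n.+1)) x j :
  injective (A^~ j) -> supports_br A x (delta_mx 0 j) ->
  trembling A x (delta_mx 0 j).
Proof.
move=> injA br; pose v : 'rV[R]_n.+1 := const_mx n.+1%:R^-1.
pose y : 'rV[R]_n.+1 := delta_mx 0 j.
pose u k : 'rV[R]_n.+1 := (1 - harmonic k) *: y + harmonic k *: v.
have h0 := @cvg_harmonic R.
have uy : u @ \oo --> y.
  apply: cvg_mx => i l; rewrite /u ord1.
  rewrite [X in _ --> X](_ : _ = (1 - 0) * y 0 l + 0 * v 0 l); last first.
    by rewrite subr0 mul1r mul0r addr0.
  under eq_fun do rewrite mxE [X in X + _]mxE [X in _ + X]mxE.
  apply: cvgD; apply: cvgM; try exact: cvg_cst; last exact: h0.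
  by apply: cvgB; [exact: cvg_cst|exact: h0].
apply: (trembling_near uy).
have h : \forall k \near \oo, forall i i', x 0 i != 0 ->
    action_payoff A (u k) i' <= action_payoff A (u k) i.
  apply: filter_forall => i; apply: filter_forall => i'.
  have [->|ii'] := eqVneq i' i; first by apply: nearW.
  have [xi|xi] := eqVneq (x 0 i) 0; first by apply: nearW.
  have d : A i j - A i' j > 0.
    rewrite subr_gt0 lt_neqAle (inj_eq injA) ii' /=.
    by have := br i xi i'; rewrite -!/(action_payoff _ _ _) !action_payoff_delta.
  rewrite -!(action_payoff_delta A) in d.
  have du : (fun k => action_payoff A (u k) i - action_payoff A (u k) i') @ \oo
      --> action_payoff A y i - action_payoff A y i'.
    by apply: cvgB; exact: cvg_action_payoff.
  near=> k; move=> _; rewrite -subr_ge0; apply: ltW.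
  by near: k; exact: (cvgr_gt _ du).
near=> k; split.
  apply: completely_mixed_conv (strategy_delta _ _) (completely_mixed_cst n).
  by rewrite harmonic_gt0/= invf_le1// ler1n.
by move=> i xi i'; move: i i' xi; near: k.
Unshelve. all: by end_near. Qed.

End Trembling.

(** * Strategies on two actions *)

Section TwoActions.
Variable R : realType.

Definition mix2 (a : R) : 'rV[R]_2 := \row_j (if j == 0 then a else 1 - a).

Lemma ord2P (i : 'I_2) : i = 0 \/ i = 1.
Proof. by case: i => [[|[|//]]] ?; [left|right]; exact/val_inj. Qed.

Lemma sum2 (F : 'I_2 -> R) : \sum_i F i = F 0 + F 1.
Proof.
rewrite !big_ord_recl big_ord0 addr0; congr (_ + F _); exact/val_inj.
Qed.

Lemma mix2_0 : mix2 0 = delta_mx 0 1.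
Proof.
by apply/rowP => j; rewrite !mxE subr0; case: (ord2P j) => ->; rewrite ?eqxx.
Qed.

Lemma mix2_1 : mix2 1 = delta_mx 0 0.
Proof.
by apply/rowP => j; rewrite !mxE subrr; case: (ord2P j) => ->; rewrite ?eqxx.
Qed.

Lemma strategy_mix2 (y : 'rV[R]_2) : strategy y ->
  0 <= y 0 0 <= 1 /\ y = mix2 (y 0 0).
Proof.
move=> [y0]; rewrite sum2 => y1; have := y0 0; have := y0 1; split; first by lra.
by apply/rowP => j; rewrite !mxE; case: (ord2P j) => ->; rewrite ?eqxx//=; lra.
Qed.

Lemma strategy2P (y : 'rV[R]_2) : strategy y ->
  completely_mixed y \/ exists j, y = delta_mx 0 j.
Proof.
move=> sy; have [y01 ->] := strategy_mix2 sy.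
have [->|y0] := eqVneq (y 0 0) 0; first by right; exists 1; rewrite mix2_0.
have [->|y1] := eqVneq (y 0 0) 1; first by right; exists 0; rewrite mix2_1.
left; split; first by have [_ <-] := strategy_mix2 sy.
by move=> i; rewrite mxE; case: (ord2P i) => ->/=;
  rewrite ?subr_gt0 lt_neqAle ?y1 1?eq_sym ?y0; lra.
Qed.

(** A completely mixed [y] serves as its own constant tremble; a pure one has a strict best response
    by injectivity. *)
Lemma trembling2 m (A : 'M[R]_(m, 2)) x y : (forall j, injective (A^~ j)) ->
  strategy y -> supports_br A x y -> trembling A x y.
Proof.
move=> injA /strategy2P[cm|[j ->]] br; first exact: trembling_completely_mixed.
exact: trembling_pure.
Qed.

End TwoActions.

Lemma card_seq_II (T : eqType) (s : seq T) : uniq s -> [set` s] #= `I_(size s).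
Proof.
(* The empty sequence is set apart because [nth] needs a default element. *)
case: s => [_|x0 s'].
  by rewrite II0 card_eq0; apply/eqP; apply/seteqP; split.
move: (x0 :: s') => {s'} s us.
have -> : [set` s] = nth x0 s @` `I_(size s).
  apply/seteqP; split=> [x /= xs|x [i /= si <-]]; last exact: mem_nth.
  by exists (index x s); [rewrite /= index_mem|rewrite nth_index].
apply: inj_card_eq => i j; rewrite !inE /= => si sj /eqP.
by rewrite nth_uniq// => /eqP.
Qed.

(** * The active game and its at most three equilibria *)

Section ActiveGame.
Variables (R : realType) (g0 gp gm : R).

Lemma trmx_active : (active_mx g0 gp gm)^T = active_mx g0 gm gp.
Proof.
apply/matrixP => i j; rewrite !mxE.
by case: (ord2P i) => ->; case: (ord2P j) => ->.
Qed.

Lemma alice_mxE : alice_mx g0 gp gm = exit_mx (active_mx g0 gp gm).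
Proof.
apply/(@matrixP _ (1 + 2) (1 + 2)) => i j; rewrite mxE.
case: (split_ordP i) => k ->; case: (split_ordP j) => l ->;
  rewrite ?exit_mxEu ?exit_mxEdl ?exit_mxEdr ?ord1 //=.
- by case: (ord2P l) => ->.
- by case: (ord2P k) => ->.
- by rewrite mxE; case: (ord2P k) => ->; case: (ord2P l) => ->.
Qed.

Lemma bob_mxE : bob_mx g0 gp gm = (exit_mx (active_mx g0 gp gm)^T)^T.
Proof.
apply/(@matrixP _ (1 + 2) (1 + 2)) => i j; rewrite mxE [RHS]mxE.
case: (split_ordP i) => k ->; case: (split_ordP j) => l ->;
  rewrite ?exit_mxEu ?exit_mxEdl ?exit_mxEdr ?ord1 //=.
- by case: (ord2P l) => ->.
- by case: (ord2P k) => ->.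
- by rewrite !mxE; case: (ord2P k) => ->; case: (ord2P l) => ->.
Qed.

(** Each column pairs [g0] with one of [gp], [gm]. *)
Lemma active_col_inj : g0 <> gp -> g0 <> gm ->
  forall j, injective ((active_mx g0 gp gm)^~ j).
Proof.
move=> ngp ngm j i i'; rewrite !mxE.
by case: (ord2P j) => ->; case: (ord2P i) => ->; case: (ord2P i') => -> //=;
  move=> /esym // /esym.
Qed.

(** Against [mix2 y], action 0 earns [y * ((g0 - gm) + (g0 - gp)) - (g0 - gp)] more than action
    1. *)
Lemma supports_br_active (x y : R) :
  supports_br (active_mx g0 gp gm) (mix2 x) (mix2 y) ->
  (x != 0 -> g0 - gp <= y * ((g0 - gm) + (g0 - gp))) /\
  (x != 1 -> y * ((g0 - gm) + (g0 - gp)) <= g0 - gp).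
Proof.
move=> br; split=> nx.
  have /br/(_ 1) : mix2 x 0 0 != 0 by rewrite mxE.
  by rewrite !sum2 !mxE /=; lra.
have /br/(_ 0) : mix2 x 0 1 != 0 by rewrite mxE/= subr_eq0 eq_sym.
by rewrite !sum2 !mxE /=; lra.
Qed.

(* For [a] and [b] of opposite signs only one off-diagonal candidate is an
   equilibrium; the quotients are junk if [a + b = 0]. *)
Definition active_candidates : seq ('rV[R]_2 * 'rV[R]_2) :=
  let a := g0 - gm in let b := g0 - gp in
  let mixed := (mix2 (a / (a + b)), mix2 (b / (a + b))) in
  if (0 < a) && (0 < b) then [:: (mix2 1, mix2 1); (mix2 0, mix2 0); mixed]
  else [:: (mix2 1, mix2 0); (mix2 0, mix2 1); mixed].

End ActiveGame.

(** With [a = g0 - gm] and [b = g0 - gp], pure equilibria on the diagonal need [a > 0] and [b > 0],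
    while [(mix2 1, mix2 0)] needs [b < 0] and [(mix2 0, mix2 1)] needs [a < 0]. *)
Lemma active_nash_candidates (R : realType) (g0 gp gm : R) p :
  g0 <> gp -> g0 <> gm -> active_nash g0 gp gm p ->
  p \in active_candidates g0 gp gm.
Proof.
case: p => x y /eqP; rewrite -subr_eq0 => b0 /eqP; rewrite -subr_eq0 => a0.
move=> /nashE[/strategy_mix2[x01 /= ->] /strategy_mix2[y01 /= ->]].
rewrite trmx_active => /supports_br_active[h1 h2] /supports_br_active.
rewrite [(g0 - gp) + _]addrC => -[h3 h4].
rewrite /active_candidates.
move: (x 0 0) (y 0 0) (g0 - gm) (g0 - gp) x01 y01 a0 b0 h1 h2 h3 h4 => {g0 gp gm}.
move=> {}x {}y a b x01 y01 a0 b0 h1 h2 h3 h4.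
(* Full mixing makes both players indifferent; [a != 0] then makes [a + b] nonzero, so the quotients
   are genuine. *)
have mixed : x != 0 -> x != 1 -> y != 0 -> y != 1 ->
    x = a / (a + b) /\ y = b / (a + b).
  move=> x0 x1 y0 y1.
  have Ex : x * (a + b) = a by apply/le_anti; rewrite h3// h4.
  have Ey : y * (a + b) = b by apply/le_anti; rewrite h1// h2.
  have ab : a + b != 0.
    by apply: contra_neq a0 => ab; rewrite -Ex ab mulr0.
  by split; [exact: canRL (mulfK ab) Ex|exact: canRL (mulfK ab) Ey].
have a_gt0 : 0 <= a -> 0 < a by rewrite lt_neqAle eq_sym a0.
have b_gt0 : 0 <= b -> 0 < b by rewrite lt_neqAle eq_sym b0.
have n10 := oner_neq0 R; have n01 : 0 != 1 :> R by rewrite eq_sym.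
(* Only profiles with both strategies pure or both mixed survive [lra]: a player who mixes against a
   pure action is indifferent, which gives [a = 0] or [b = 0]. *)
have [x0|x0] := eqVneq x 0; have [x1|x1] := eqVneq x 1;
  have [y0|y0] := eqVneq y 0; have [y1|y1] := eqVneq y 1;
  rewrite ?(eqxx, x0, x1, y0, y1, n10, n01) /= in h1 h2 h3 h4 mixed *; try lra.
all: rewrite ?(mul0r, mul1r) in h1 h2 h3 h4.
all: case: ifP => [/andP[ap bp]|/negP ab].
all: try by rewrite !inE eqxx ?orbT.
- by case: ab; rewrite a_gt0 ?h4 ?b_gt0 ?h2.
- by have := h3 isT; rewrite leNgt ap.
- by have := h1 isT; rewrite leNgt bp.
- case: ab; rewrite a_gt0 ?b_gt0//; [have := h3 isT|have := h1 isT]; lra.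
- by have [-> ->] := mixed isT isT isT isT; rewrite !inE eqxx !orbT.
- by have [-> ->] := mixed isT isT isT isT; rewrite !inE eqxx !orbT.
Qed.

Lemma active_nash_seq (R : realType) (g0 gp gm : R) :
  g0 <> gp -> g0 <> gm ->
  exists s, [/\ uniq s, (size s <= 3)%N & [set` s] =
    [set p | active_nash g0 gp gm p /\ 0 < reward g0 gp gm p]].
Proof.
move=> ngp ngm; set P := [set p | _].
pose c := active_candidates g0 gp gm.
(* [undup] spares a proof that the candidates are distinct. *)
exists (undup [seq p <- c | `[< P p >]]); split.
- exact: undup_uniq.
- apply: leq_trans (size_undup _) _; rewrite size_filter.
  by apply: leq_trans (count_size _ _) _; rewrite /c /active_candidates; case: ifP.
- apply/seteqP; split=> p /=; rewrite mem_undup mem_filter.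
    by move=> /andP[/asboolP].
  move=> Pp; apply/andP; split; first exact/asboolP.
  by apply: active_nash_candidates => //; case: Pp.
Qed.

(** * Counting the equilibria of the three-action game *)

Definition play_both (R : realType) m n (s : R) (p : 'rV[R]_m * 'rV[R]_n) :=
  (play s p.1, play s p.2).

Lemma play_both_inj (R : realType) m n s t (p q : 'rV[R]_m * 'rV[R]_n) :
  s != 0 -> play_both s p = play_both t q -> s = t /\ p = q.
Proof.
case: p q => x y [x' y'] s0 /pair_equal_spec[/= h1 h2].
by have [-> ->] := play_inj s0 h1; have [_ ->] := play_inj s0 h2.
Qed.

Theorem theoremS5p1 (R : realType) (g0 gp gm : R)
  (g0_neq_gp : g0 <> gp) (g0_neq_gm : g0 <> gm)
  (reward_neq0 : forall p : 'rV[R]_2 * 'rV[R]_2,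
     active_nash g0 gp gm p -> reward g0 gp gm p <> 0) :
  exists nplus : nat,
    [/\ [set p | active_nash g0 gp gm p /\ 0 < reward g0 gp gm p]
          #= `I_nplus,
        [set p | nash (alice_mx g0 gp gm) (bob_mx g0 gp gm) p]
          #= `I_(1 + 2 * nplus),
        (forall p, nash (alice_mx g0 gp gm) (bob_mx g0 gp gm) p ->
           trembling_hand_perfect (alice_mx g0 gp gm) (bob_mx g0 gp gm) p),
        [set p | trembling_hand_perfect (alice_mx g0 gp gm) (bob_mx g0 gp gm) p]
          #= `I_(1 + 2 * nplus) &
        (1 + 2 * nplus)%N \in [:: 1; 3; 5; 7]%N].
Proof.
have [s [us s3 sE]] := active_nash_seq g0_neq_gp g0_neq_gm.
set G := active_mx g0 gp gm.
have nash3E p : nash (alice_mx g0 gp gm) (bob_mx g0 gp gm) p <->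
    p = (play 0 0, play 0 0) \/ exists q t, [/\ nash G G q, 0 < payoff G q.1 q.2,
      t = 1 \/ t = (1 + payoff G q.1 q.2)^-1 & p = play_both t q].
  by rewrite alice_mxE bob_mxE; exact: nash_exit.
pose f1 : _ -> 'rV[R]_(1 + 2) * 'rV[R]_(1 + 2) := @play_both R 2 2 1.
pose f2 q := play_both (1 + payoff G q.1 q.2)^-1 q.
have r_gt0 q : q \in s -> 0 < payoff G q.1 q.2.
  by move=> qs; have : [set` s] q by []; rewrite sE => -[].
pose L := (play 0 0, play 0 0) :: map f1 s ++ map f2 s.
have nashE3 : [set p | nash (alice_mx g0 gp gm) (bob_mx g0 gp gm) p] = [set` L].
  apply/seteqP; split=> p /=; rewrite nash3E inE mem_cat.
    case=> [->|[q [t [nq rq tE ->]]]]; first by rewrite eqxx.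
    have qs : q \in s by have : [set` s] q by rewrite sE.
    apply/orP; right; apply/orP.
    by case: tE => ->; [left|right]; apply: map_f.
  case/or3P => [/eqP->|/mapP[q qs ->]|/mapP[q qs ->]]; first by left.
    right; exists q, 1; split=> //; [|exact: r_gt0|by left].
    by have : [set` s] q by []; rewrite sE => -[].
  right; exists q, (1 + payoff G q.1 q.2)^-1; split=> //; [|exact: r_gt0|by right].
  by have : [set` s] q by []; rewrite sE => -[].
have sizeL : size L = (1 + 2 * size s)%N.
  by rewrite /= size_cat !size_map addnn mul2n.
have ns1 q : q \in s -> 1 + payoff G q.1 q.2 != 0.
  by move=> /r_gt0 rq; apply: lt0r_neq0; rewrite addr_gt0.
have exit_neq t q : t != 0 -> play_both t q <> (play 0 0, play 0 0).
  (* Sure exit is read as [play_both 0 (0, 0)], so injectivity would give [t = 0]. *)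
  by move=> t0 /(@play_both_inj _ _ _ _ _ _ (0, 0) t0)[/eqP]; rewrite (negbTE t0).
have uniqL : uniq L.
  rewrite /L cons_uniq cat_uniq; apply/and4P; split.
  - rewrite mem_cat; apply/norP; split; apply/mapP => -[q qs /esym].
      exact: exit_neq (oner_neq0 _).
    by apply: exit_neq; rewrite invr_eq0 ns1.
  - rewrite map_inj_uniq// => q q' /play_both_inj.
    by case; first exact: oner_neq0.
  (* The two families are disjoint: [(1 + r)^-1 = 1] would give [r = 0]. *)
  - apply/hasPn => _ /mapP[q qs ->]; apply/mapP => -[q' _].
    case/play_both_inj; first by rewrite invr_eq0 ns1.
    move=> /(congr1 GRing.inv); rewrite invrK invr1 => rq _.
    by have := r_gt0 _ qs; lra.
  - rewrite map_inj_in_uniq// => q q' qs _ /play_both_inj.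
    by case; first by rewrite invr_eq0 ns1.
have thp p : nash (alice_mx g0 gp gm) (bob_mx g0 gp gm) p ->
    trembling_hand_perfect (alice_mx g0 gp gm) (bob_mx g0 gp gm) p.
  move=> np; have /nashE[sx sy _ _] := np.
  apply/trembling_hand_perfectE; split=> //; rewrite ?alice_mxE ?bob_mxE ?trmxK.
    move/nash3E : np => [->|[q [t [/nashE[sq1 sq2 b1 b2] rq tE ->]]]].
      exact: trembling_exit.
    apply: trembling_play => //; apply: trembling2 => //.
    exact: active_col_inj.
  move/nash3E : np => [->|[q [t [/nashE[sq1 sq2 b1 b2] rq tE ->]]]].
    exact: trembling_exit.
  apply: trembling_play; rewrite ?payoff_trmx//.
  (* Transposition swaps [gp] and [gm], so the two hypotheses exchange roles. *)
  rewrite trmx_active in b2 *; apply: trembling2 => //.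
  exact: active_col_inj.
have card3 : [set` L] #= `I_(1 + 2 * size s) by rewrite -sizeL; exact: card_seq_II.
exists (size s); split=> //.
- by rewrite -sE; exact: card_seq_II.
- by rewrite nashE3.
- suff -> : [set p | trembling_hand_perfect (alice_mx g0 gp gm)
      (bob_mx g0 gp gm) p] = [set` L] by [].
  rewrite -nashE3; apply/seteqP; split=> p; last exact: thp.
  exact: trembling_hand_perfect_nash.
- by case: (size s) s3 => [|[|[|[|]]]].
Qed.
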